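(* Let $T$ be a tree with $n\ge 2$ vertices and maximum degree $\Delta$. Then $\operatorname{bp}(T)<\Delta^2 n\log n$.
   Context: $\log$ is the base-two logarithm. A planar drawing $\Gamma$ of a graph is a straight-line drawing in the plane (distinct vertices at distinct points, edges drawn as segments) in which no two edges intersect in a point that is interior to at least one of them. $d_\Gamma(u,v)$ is the Euclidean distance between the points of $u$ and $v$. For a planar drawing $\Gamma$ of a tree $T$, a pair of non-adjacent vertices $u,v$ is a bad pair if there is an edge $wz$ on the path from $u$ to $v$ in $T$ with $d_\Gamma(u,v)<d_\Gamma(w,z)$. $\operatorname{bp}(T)$ is the smallest number of bad pairs over all planar drawings of $T$. *)

(* Defs.v *)
From HB Require Import structures.
From mathcomp Require Import all_boot all_order all_algebra.
From mathcomp Require Import all_classical all_reals.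
From mathcomp Require Import ereal exp.
Set Implicit Arguments.
Unset Strict Implicit.
Unset Printing Implicit Defensive.
Import Order.TTheory GRing.Theory Num.Theory.
Local Open Scope ring_scope.

Definition simple_graph (T : finType) (e : rel T) : Prop :=
  symmetric e /\ irreflexive e.

(* A [ucycle] with at most two vertices is a vertex without edges, or an edge
   traversed back and forth, so the last clause excludes exactly the graph
   cycles. *)
Definition is_tree (T : finType) (e : rel T) : Prop :=
  [/\ simple_graph e, (0 < #|T|)%N, forall x y, connect e x y
    & forall c : seq T, ucycle e c -> (size c <= 2)%N].

Definition max_degree (T : finType) (e : rel T) : nat :=
  \max_(x : T) #|[set y | e x y]%SET|.

Definition log2 (R : realType) (x : R) : R := ln x / ln 2.

(* The norm that the library puts on [R * R] is the sup norm, hence this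
   explicit definition. *)
Definition edist (R : realType) (a b : R * R) : R :=
  Num.sqrt ((a.1 - b.1) ^+ 2 + (a.2 - b.2) ^+ 2).

Definition segpoint (R : realType) (a b : R * R) (t : R) : R * R :=
  ((1 - t) * a.1 + t * b.1, (1 - t) * a.2 + t * b.2).

Definition segment (R : realType) (a b : R * R) : set (R * R) :=
  [set x | exists2 t, 0 <= t <= 1 & x = segpoint a b t]%classic.

Definition segment_interior (R : realType) (a b : R * R) : set (R * R) :=
  [set x | exists2 t, 0 < t < 1 & x = segpoint a b t]%classic.

(* The two edges play exchangeable roles, so it is enough to exclude points
   that are interior to the first one. *)
Definition planar_drawing (R : realType) (T : finType) (e : rel T)
    (G : T -> R * R) : Prop :=
  injective G /\
  forall u v w z : T, e u v -> e w z -> [set u; v]%SET != [set w; z]%SET ->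
    (segment_interior (G u) (G v) `&` segment (G w) (G z) = set0)%classic.

Definition simple_path (T : finType) (e : rel T) (u v : T) (p : seq T) : Prop :=
  [/\ path e u p, last u p = v & uniq (u :: p)].

Definition bad (R : realType) (T : finType) (e : rel T) (G : T -> R * R)
    (u v : T) : Prop :=
  [/\ u != v, ~~ e u v
    & exists p w z, [/\ simple_path e u v p, infix [:: w; z] (u :: p)
        & edist (G u) (G v) < edist (G w) (G z)]].

(* Pairs of vertices are unordered. *)
Definition bad_pairs (R : realType) (T : finType) (e : rel T)
    (G : T -> R * R) : {set {set T}} :=
  [set [set x.1; x.2] | x : T * T & `[< bad e G x.1 x.2 >]]%SET.

(* The infimum lives in the extended reals so that it would be +oo, and not 0,
   if there were no planar drawing; otherwise it is attained, see [bp_min]. *)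
Definition bp (R : realType) (T : finType) (e : rel T) : \bar R :=
  ereal_inf [set (#|bad_pairs e G|%:R)%:E | G in @planar_drawing R T e]%classic.

Lemma bp_min (R : realType) (T : finType) (e : rel T) :
  (exists G : T -> R * R, planar_drawing e G) ->
  exists G : T -> R * R,
    [/\ planar_drawing e G, bp R e = (#|bad_pairs e G|%:R)%:E
      & forall G' : T -> R * R, planar_drawing e G' ->
          (#|bad_pairs e G| <= #|bad_pairs e G'|)%N].
Proof.
move=> [G0 HG0].
pose P k := `[< exists2 G : T -> R * R, planar_drawing e G & #|bad_pairs e G| = k >].
have exP : exists k, P k by exists #|bad_pairs e G0|; apply/asboolP; exists G0.
case: (ex_minnP exP) => k /asboolP[G HG Gk] kmin.
have Gmin (G' : T -> R * R) : planar_drawing e G' -> (#|bad_pairs e G| <= #|bad_pairs e G'|)%N.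
  by move=> HG'; rewrite Gk; apply: kmin; apply/asboolP; exists G'.
exists G; split => //; apply/eqP; rewrite eq_le; apply/andP; split.
  by apply: ereal_inf_lbound; exists G.
by apply: le_ereal_inf_tmp => _ [G' HG' <-]; rewrite lee_fin ler_nat Gmin.
Qed.

(* Main.v *)
Require Import Defs.
From mathcomp Require Import all_boot all_order all_algebra.
From mathcomp Require Import all_classical all_reals.
From mathcomp Require Import ereal exp.
From mathcomp Require Import ring lra.

Set Implicit Arguments.
Unset Strict Implicit.
Unset Printing Implicit Defensive.
Import Order.TTheory GRing.Theory Num.Theory.
Local Open Scope ring_scope.

(** Root the tree and number its vertices so that, whenever [c] and [c'] are
    siblings and the subtree of [c] is the smaller one, all numbers in the
    subtree of [c] are below all those in the subtree of [c'].  Draw the edge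
    above a vertex of number [i] as the vector [(3n)^i (1, i/n)].  Disjoint
    subtrees then use disjoint ranges of slopes, which makes the drawing planar,
    and all the edges of the lighter one are negligible against each edge of the
    heavier one.  As all edges point in directions at most 45 degrees apart, a
    bad pair [u, v] with lowest common ancestor [x] forces the end point on the
    heavier side, say [u], to be a child of [x].  So [u] is a sibling of an
    ancestor [c] of [v], and the subtree of [c] is at most as large as that of
    [u].  Each [v] has at most [log n] such ancestors [c], because the size of
    the subtree doubles at each of them, and each [c] has at most [Delta - 1]
    siblings. *)

(** * Rooting a tree *)

Record rooting (T : finType) (e : rel T) := Rooting {
  root : T;
  par : T -> T;
  depth : T -> nat;
  par_root : par root = root;
  adj_par : forall v, v != root -> e v (par v);
  depth_par : forall v, v != root -> (depth (par v) < depth v)%N;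
  adj_rooting : forall u v,
    e u v -> (v = par u /\ u != root) \/ (u = par v /\ v != root) }.

(** [d] is the distance to [r]: the next vertex on a shortest path to [r] is closer. *)
Lemma decreasing_neighbours (T : finType) (e : rel T) (r : T) :
  (forall v, connect e v r) ->
  exists d : T -> nat, forall v, v != r -> exists2 y, e v y & (d y < d v)%N.
Proof.
move=> conn.
pose P v n := `[< exists p, [/\ path e v p, last v p = r & size p = n] >].
have exP v : exists n, P v n.
  by have /connectP[p pp lp] := conn v; exists (size p); apply/asboolP; exists p.
exists (fun v => ex_minn (exP v)) => v nvr.
case: (ex_minnP (exP v)) => n /asboolP[[|y p] [/= pp lp sz]] _.
  by rewrite lp eqxx in nvr.
case/andP: pp => evy pp; exists y => //.
case: (ex_minnP (exP y)) => m _ /(_ (size p)); rewrite -sz ltnS; apply.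
by apply/asboolP; exists p.
Qed.

(** An edge that is not a parent edge would close a cycle with a simple path of parent edges between
    its ends. *)
Lemma tree_adj_par (T : finType) (e : rel T) (r : T) (par : T -> T) :
  is_tree e -> (forall v, v != r -> e v (par v)) ->
  (forall v, connect (fun x y => (x != r) && (y == par x)) v r) ->
  forall u v, e u v -> (v = par u /\ u != r) \/ (u = par v /\ v != r).
Proof.
case=> [[esym eirr] _ _ acyc] adj conn u v euv.
have [/andP[unr /eqP vE]|nuv] := boolP ((u != r) && (v == par u)).
  by left.
have [/andP[vnr /eqP uE]|nvu] := boolP ((v != r) && (u == par v)).
  by right.
exfalso.
pose e0 x y := ((x != r) && (y == par x)) || ((y != r) && (x == par y)).
have e0sym : connect_sym e0.
  by apply: sym_connect_sym => x y; rewrite /e0 orbC.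
have e0sub : subrel e0 e.
  move=> x y /orP[/andP[xr /eqP->]|/andP[yr /eqP->]]; first exact: adj.
  by rewrite esym; apply: adj.
have conn0 x : connect e0 x r.
  apply: connect_sub (conn x) => a b ab.
  by apply: connect1; rewrite /e0 ab.
have /connectP[p pp lp] : connect e0 u v.
  by apply: connect_trans (conn0 u) _; rewrite e0sym.
case: (shortenP pp) lp => q qp uq _ lq {p pp}.
(* Acyclicity leaves [q] at most one vertex: either [u = v], a loop, or [u] and [v] are joined by a
   parent edge after all. *)
have := acyc (u :: q); rewrite /ucycle uq andbT /= rcons_path.
rewrite (sub_path e0sub qp) -lq esym euv => /(_ isT).
case: q qp uq lq => [|a [|//]] /=.
  by move=> _ _ vu; rewrite vu eirr in euv.
by rewrite andbT => e0ua _ va; move: e0ua; rewrite -va /e0 (negbTE nuv) (negbTE nvu).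
Qed.

Lemma tree_rooting (T : finType) (e : rel T) : is_tree e -> inhabited (rooting e).
Proof.
move=> He; have [_ /card_gt0P[r _] conn _] := He.
have [d dP] := decreasing_neighbours (conn^~ r).
have /choice[par parP] : forall v, exists y,
    if v == r then y = r else e v y /\ (d y < d v)%N.
  move=> v; case: (eqVneq v r) => [_|nvr]; first by exists r.
  by have [y ? ?] := dP v nvr; exists y.
have parr : par r = r by have := parP r; rewrite eqxx.
have adj v : v != r -> e v (par v).
  by move=> nvr; have := parP v; rewrite (negbTE nvr) => -[].
have dpar v : v != r -> (d (par v) < d v)%N.
  by move=> nvr; have := parP v; rewrite (negbTE nvr) => -[].
constructor; apply: (@Rooting _ _ r par d) => //.
apply: tree_adj_par => // v.
have [n] := ubnP (d v); elim: n v => // n IH v dv.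
case: (eqVneq v r) => [->//|nvr].
apply: (@connect_trans _ _ (par v)); first by apply: connect1; rewrite nvr eqxx.
by apply: IH; apply: leq_trans (dpar v nvr) _.
Qed.

(** * The ancestor order *)

Definition below (T : finType) (e : rel T) (F : rooting e) (v c : T) : bool :=
  fconnect (par F) v c.

Lemma below_refl (T : finType) (e : rel T) (F : rooting e) v : below F v v.
Proof. exact: connect0. Qed.

Lemma below_trans (T : finType) (e : rel T) (F : rooting e) :
  transitive (below F).
Proof. by move=> y x z; apply: connect_trans. Qed.

Lemma below_par (T : finType) (e : rel T) (F : rooting e) v : below F v (par F v).
Proof. exact: fconnect1. Qed.

Lemma belowE (T : finType) (e : rel T) (F : rooting e) v c :
  below F v c = (v == c) || below F (par F v) c.
Proof. exact: fconnect_eqVf. Qed.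

Lemma below_rootl (T : finType) (e : rel T) (F : rooting e) c :
  below F (root F) c -> c = root F.
Proof.
move=> /iter_findex <-; elim: (findex _ _ _) => //= n ->; exact: par_root.
Qed.

Lemma below_depth (T : finType) (e : rel T) (F : rooting e) v c :
  below F v c -> (depth F c <= depth F v)%N.
Proof.
move=> /iter_findex <-; elim: (findex _ _ _) => //= n IH; apply: leq_trans IH.
set w := iter _ _ _; have [->|nwr] := eqVneq w (root F).
  by rewrite par_root.
exact: ltnW (depth_par nwr).
Qed.

Lemma below_depth_lt (T : finType) (e : rel T) (F : rooting e) v c :
  below F v c -> v != c -> (depth F c < depth F v)%N.
Proof.
move=> vc nvc; have nvr : v != root F.
  by apply: contraNneq nvc => vr; move: vc; rewrite vr => /below_rootl->.
move: vc; rewrite belowE (negbTE nvc) /= => /below_depth dc.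
exact: leq_ltn_trans dc (depth_par nvr).
Qed.

Lemma below_anti (T : finType) (e : rel T) (F : rooting e) v c :
  below F v c -> below F c v -> v = c.
Proof.
move=> vc /below_depth cv; apply/eqP; apply: contraLR cv => /(below_depth_lt vc).
by rewrite ltnNge.
Qed.

Lemma below_root (T : finType) (e : rel T) (F : rooting e) v : below F v (root F).
Proof.
have [n] := ubnP (depth F v); elim: n v => // n IH v dv.
case: (eqVneq v (root F)) => [->|nvr]; first exact: below_refl.
by rewrite belowE IH ?orbT //; apply: leq_trans (depth_par nvr) _.
Qed.

(** Ancestors of [v] are iterates of the parent map at [v], and the longer iteration continues the
    shorter one. *)
Lemma below_total (T : finType) (e : rel T) (F : rooting e) v a b :
  below F v a -> below F v b -> below F a b || below F b a.
Proof.
move=> /iter_findex; set i := findex _ _ _ => <-.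
move=> /iter_findex; set j := findex _ _ _ => <-.
wlog ij : i j / (i <= j)%N.
  by move=> H; case: (leqP i j) => [|/ltnW] /H //; rewrite orbC.
by apply/orP; left; rewrite -(subnK ij) iterD; apply: fconnect_iter.
Qed.

(** * Siblings and the numbering of the vertices *)

Definition sib (T : finType) (e : rel T) (F : rooting e) (c c' : T) : bool :=
  [&& c != root F, c' != root F, c != c' & par F c == par F c'].

Lemma sib_sym (T : finType) (e : rel T) (F : rooting e) : symmetric (sib F).
Proof.
by move=> c c'; rewrite /sib eq_sym [c' == c]eq_sym [par F c' == _]eq_sym andbCA.
Qed.

Lemma sib_nbelow (T : finType) (e : rel T) (F : rooting e) c c' :
  sib F c c' -> ~~ below F c c'.
Proof.
case/and4P=> _ c'r ncc' /eqP pE; rewrite belowE (negbTE ncc') pE /=.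
by apply/negP => /below_depth; rewrite leqNgt depth_par.
Qed.

Lemma sib_disjoint (T : finType) (e : rel T) (F : rooting e) c c' v :
  sib F c c' -> below F v c -> ~~ below F v c'.
Proof.
move=> s vc; apply/negP => /(below_total vc).
by rewrite (negbTE (sib_nbelow s)) -[_ || _]/(below F c' c) (negbTE (sib_nbelow _)) // sib_sym.
Qed.

Definition subtree (T : finType) (e : rel T) (F : rooting e) (c : T) : {set T} :=
  [set v | below F v c]%SET.

(* The [enum_rank] summand only breaks ties between subtrees of equal size. *)
Definition weight (T : finType) (e : rel T) (F : rooting e) (c : T) : nat :=
  (#|subtree F c| * #|T| + enum_rank c)%N.

Lemma weight_inj (T : finType) (e : rel T) (F : rooting e) : injective (weight F).
Proof.
move=> c c' /(congr1 (modn^~ #|T|)); rewrite /weight !modnMDl !modn_small //.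
by move=> /val_inj/enum_rank_inj.
Qed.

Lemma weight_subtree (T : finType) (e : rel T) (F : rooting e) c c' :
  (weight F c < weight F c')%N -> (#|subtree F c| <= #|subtree F c'|)%N.
Proof.
apply: contraTT; rewrite -ltnNge -leqNgt /weight => lt.
have : (#|subtree F c'|.+1 * #|T| <= #|subtree F c| * #|T|)%N by rewrite leq_mul2r lt orbT.
rewrite mulSn => h; have lt' : (enum_rank c' < #|T|)%N := ltn_ord (enum_rank c').
by apply: leq_trans (leq_addr _ _); apply: leq_trans h; rewrite addnC ltnW // ltn_add2r.
Qed.

Definition light_sib (T : finType) (e : rel T) (F : rooting e) (c c' : T) : bool :=
  sib F c c' && (weight F c < weight F c')%N.

Definition earlier (T : finType) (e : rel T) (F : rooting e) (z v : T) : bool :=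
  [exists c, exists c', [&& light_sib F c c', below F z c & below F v c']].

(** A vertex may share its number with an ancestor; only vertices in different sibling subtrees have
    to be told apart. *)
Definition index (T : finType) (e : rel T) (F : rooting e) (v : T) : nat :=
  #|[set z | earlier F z v]%SET|.

Lemma index_le (T : finType) (e : rel T) (F : rooting e) v : (index F v <= #|T|)%N.
Proof. exact: max_card. Qed.

Lemma earlierP (T : finType) (e : rel T) (F : rooting e) z v :
  reflect (exists c c', [/\ light_sib F c c', below F z c & below F v c'])
    (earlier F z v).
Proof.
apply: (iffP existsP) => [[c /existsP[c' /and3P[? ? ?]]]|[c [c' [? ? ?]]]].
  by exists c, c'.
by exists c; apply/existsP; exists c'; apply/and3P.
Qed.

(** The set counted for [a] is strictly contained in the one counted for [b]: [a] is earlier than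
    [b], but not than itself, because sibling subtrees are disjoint. *)
Lemma index_light_sib (T : finType) (e : rel T) (F : rooting e) c c' a b :
  light_sib F c c' -> below F a c -> below F b c' -> (index F a < index F b)%N.
Proof.
move=> lcc' ac bc'; have /andP[scc' wcc'] := lcc'.
have /and4P[cr c'r ncc' /eqP pE] := scc'.
apply: proper_card; apply/properP; split; last first.
  exists a; rewrite !inE; first by apply/earlierP; exists c, c'.
  apply/earlierP => -[w [w' [/andP[sww' _] aw]]]; exact/negP/(sib_disjoint sww').
apply/fintype.subsetP => z; rewrite !inE => /earlierP[w' [w [lw zw' aw]]].
apply/earlierP; have /andP[sw ww] := lw; have /and4P[w'r wr nw /eqP pw] := sw.
(* Both [w] and [c] are ancestors of [a]. If they coincide, [w'] is lighter than [c']; if [w] is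
   strictly below [c], the subtree of [w'] lies in that of [c]; if [c] is strictly below [w], so is
   its sibling [c'], and [b] lies below [w]. *)
have [wc|nwc] := eqVneq w c.
  exists w', c'; split=> //; rewrite /light_sib -wc in wcc' pE ncc' *.
  rewrite (ltn_trans ww wcc') andbT /sib w'r c'r pw pE eqxx andbT /=.
  by apply: contraTneq wcc' => <-; rewrite -leqNgt ltnW.
have /orP[bwc|bcw] := below_total aw ac.
  exists c, c'; split=> //; apply: below_trans zw' _.
  rewrite belowE pw; apply/orP; right; move: bwc; by rewrite belowE (negbTE nwc).
exists w', w; split=> //; apply: below_trans bc' _.
move: bcw; rewrite belowE eq_sym (negbTE nwc) /= pE => h.
exact: below_trans (below_par _ _) h.
Qed.

(** * The two branches of a path *)

(** The vertices from [u] up to, but excluding, the lowest common ancestor with [v]. Each stands for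
    the edge to its parent, so the two branches of a pair make up the edges of its path. *)
Definition branch (T : finType) (e : rel T) (F : rooting e) (u v : T) : {set T} :=
  [set c | below F u c && ~~ below F v c]%SET.

(** A vertex of least depth in the branch is the child of the lowest common ancestor on the side of
    [u]. *)
Lemma branch_top (T : finType) (e : rel T) (F : rooting e) u v :
  branch F u v != finset.set0 -> exists c,
    [/\ c \in branch F u v, c != root F, below F v (par F c)
      & {in branch F u v, forall a, below F a c}].
Proof.
move=> /set0Pn[c0 c0U].
have [c cU cmin] : exists2 c, c \in branch F u v &
    {in branch F u v, forall a, depth F c <= depth F a}%N.
  by case: (arg_minnP (depth F) c0U) => c; exists c.
have := cU; rewrite inE => /andP[uc nvc].
have cr : c != root F by apply: contraNneq nvc => ->; exact: below_root.
exists c; split=> //; last first.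
  move=> a aU; have := aU; rewrite inE => /andP[ua _].
  have /orP[//|ca] := below_total ua uc; have [->|ac] := eqVneq c a; first exact: below_refl.
  by have := cmin a aU; rewrite leqNgt below_depth_lt.
apply: contraT => npar; have: par F c \in branch F u v.
  by rewrite inE npar andbT; apply: below_trans uc (below_par _ _).
by move=> /cmin; rewrite leqNgt depth_par.
Qed.

Lemma branch_sib (T : finType) (e : rel T) (F : rooting e) u v :
  branch F u v != finset.set0 -> branch F v u != finset.set0 -> exists c c',
    [/\ sib F c c', c \in branch F u v, c' \in branch F v u,
      {in branch F u v, forall a, below F a c}
      & {in branch F v u, forall a, below F a c'}].
Proof.
move=> /branch_top[c [cU cr vc cmax]] /branch_top[c' [c'U c'r uc' c'max]].
exists c, c'; split=> //; rewrite /sib cr c'r /=.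
move: cU c'U; rewrite !inE => /andP[uc nvc] /andP[vc' nuc'].
apply/andP; split; first by apply: contraNneq nvc => ->.
(* Applied in both directions, this makes the parents of the two top vertices equal by
   antisymmetry. *)
have below_pars x y w z : below F w x -> ~~ below F z x -> below F w (par F y) ->
    below F z y -> below F (par F x) (par F y).
  move=> wx nzx wy zy; have /orP[|h] := below_total wx wy.
    rewrite belowE => /orP[/eqP xE|//].
    by rewrite xE (below_trans zy (below_par _ _)) in nzx.
  by rewrite (below_trans (below_trans zy (below_par _ _)) h) in nzx.
apply/eqP; apply: below_anti.
  exact: below_pars uc nvc uc' vc'.
exact: below_pars vc' nuc' vc uc.
Qed.

(** The tops of the two branches are siblings of different weight, and the order of their weights
    passes to the numbers of all vertices below them. An empty branch makes either side vacuous. *)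
Lemma branch_index (T : finType) (e : rel T) (F : rooting e) u v :
  {in branch F u v & branch F v u, forall a b, index F a < index F b}%N \/
  {in branch F u v & branch F v u, forall a b, index F b < index F a}%N.
Proof.
have [->|U0] := eqVneq (branch F u v) finset.set0; first by left=> a b; rewrite inE.
have [->|V0] := eqVneq (branch F v u) finset.set0; first by left=> a b _; rewrite inE.
have [c [c' [s _ _ Uc Vc']]] := branch_sib U0 V0.
have /and4P[_ _ ncc' _] := s.
have : (weight F c < weight F c')%N || (weight F c' < weight F c)%N.
  by rewrite -neq_ltn; apply: contraNneq ncc' => /weight_inj->.
case/orP=> w; [left|right]=> a b /Uc ac /Vc' bc'.
  by apply: (@index_light_sib _ _ F c c') => //; rewrite /light_sib s.
by apply: (@index_light_sib _ _ F c' c) => //; rewrite /light_sib sib_sym s.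
Qed.

(** * Edges on a path *)

(** The ancestors of a vertex are itself and those of its parent, so membership in the subtree of
    [c] changes only across the edge above [c]. *)
Lemma adj_below (T : finType) (e : rel T) (F : rooting e) c x y :
  e x y -> below F x c != below F y c ->
  c != root F /\ ((x, y) = (c, par F c) \/ (x, y) = (par F c, c)).
Proof.
move=> exy nxy; have cr : c != root F.
  by apply: contraNneq nxy => ->; rewrite !below_root.
split=> //; case: (adj_rooting F exy) => -[E _]; move: nxy; rewrite {}E.
  by rewrite belowE; have [->|] := eqVneq x c; [left|rewrite eqxx].
by rewrite [X in _ != X]belowE; have [->|] := eqVneq y c; [right|rewrite eqxx].
Qed.

Lemma path_cross (T : finType) (e : rel T) (F : rooting e) c a p :
  path e a p -> below F a c != below F (last a p) c ->
  (c \in a :: p) && (par F c \in a :: p).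
Proof.
elim: p a => [|y p IH] a /=; first by rewrite eqxx.
case/andP=> eay pp; have [->|nay] := eqVneq (below F a c) (below F y c).
  by move=> /(IH y pp) /andP[? ?]; apply/andP; split; apply: mem_behead.
by move=> _; have [_ [] []-> ->] := adj_below eay nay; rewrite !inE !eqxx !orbT.
Qed.

(* The path leaves the edge [{w, z}] only once, so its end points lie on
   different sides of that edge. *)
Lemma simple_path_edge (T : finType) (e : rel T) (F : rooting e) u v p w z :
  simple_path e u v p -> infix [:: w; z] (u :: p) ->
  exists c, [/\ c != root F, below F u c != below F v c
    & (w, z) = (c, par F c) \/ (w, z) = (par F c, c)].
Proof.
move=> [pp lp up] /infixP[s1 [s2 E]].
have {}E : u :: p = rcons s1 w ++ z :: s2 by rewrite E cat_rcons.
have ewz : e w z.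
  move: pp; rewrite -[path e u p]/(sorted e (u :: p)) E cat_rcons.
  by move=> /cat_sorted2[_ /= /andP[]].
have [c wzc] : exists c, below F w c != below F z c.
  case: (adj_rooting F ewz) => -[-> r].
    exists w; rewrite below_refl; apply/negP => /eqP/esym/below_depth.
    by rewrite leqNgt depth_par.
  exists z; rewrite below_refl; apply/negP => /eqP/below_depth.
  by rewrite leqNgt depth_par.
have [cr cwz] := adj_below ewz wzc.
have onesided q : (w \in q) && (z \in q) = (c \in q) && (par F c \in q).
  by case: cwz => -[-> ->] //; rewrite andbC.
(* Uniqueness keeps [w] out of the second half and [z] out of the first. *)
have nodup q : uniq (rcons s1 w ++ z :: s2) ->
    q = rcons s1 w \/ q = z :: s2 -> ~~ ((w \in q) && (z \in q)).
  rewrite cat_uniq => /and3P[_ /hasPn h _] [] ->.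
    by rewrite negb_and (h z) ?orbT // mem_head.
  by rewrite negb_and; apply/orP; left; apply: (contraL (h w));
    rewrite mem_rcons mem_head.
exists c; split=> //.
(* Otherwise the first half would cross the edge above [c], hence contain both of its ends. *)
have ->: below F u c = below F w c.
  apply/eqP/negPn/negP => nuw.
  have: uniq (rcons s1 w ++ z :: s2) by rewrite -E.
  move=> /nodup /(_ (or_introl erefl)) /negP[]; rewrite onesided {nodup}.
  case: s1 E => [|a s1] E; first by case: E nuw => ->; rewrite eqxx.
  case: E nuw pp => <- ->; rewrite cat_path => nuw /andP[pw _].
  by rewrite rcons_cons; apply: (path_cross pw); rewrite last_rcons.
have -> // : below F v c = below F z c.
apply/eqP/negPn/negP => nvz.
have: uniq (rcons s1 w ++ z :: s2) by rewrite -E.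
move=> /nodup /(_ (or_intror erefl)) /negP[]; rewrite onesided.
apply: path_cross.
  by move: pp; rewrite -[path e u p]/(sorted e (u :: p)) E => /cat_sorted2[].
suff -> : last z s2 = v by rewrite eq_sym.
by rewrite -lp -[last u p]/(last u (u :: p)) E last_cat.
Qed.

(** * Counting heavier siblings of ancestors *)

Definition heavier (T : finType) (e : rel T) (F : rooting e) (v : T) : {set T} :=
  [set u | [exists c, below F v c && light_sib F c u]]%SET.

Definition light_ancestors (T : finType) (e : rel T) (F : rooting e) (v : T) : {set T} :=
  [set c | below F v c && [exists c', light_sib F c c']]%SET.

(** Induction down the tree. If [v] has a heavier sibling, one light ancestor is gained, but the two
    disjoint subtrees fit into that of the parent, so the size at least halves. Otherwise no light
    ancestor is gained. *)
Lemma card_light_ancestors (T : finType) (e : rel T) (F : rooting e) v :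
  (2 ^ #|light_ancestors F v| * #|subtree F v| <= #|T|)%N.
Proof.
have [n] := ubnP (depth F v); elim: n v => // n IH v dv.
have [->|nvr] := eqVneq v (root F).
  have -> : light_ancestors F (root F) = finset.set0.
    apply/setP => c; rewrite !inE; apply/negP => /andP[/below_rootl-> /existsP[c']].
    by rewrite /light_sib /sib eqxx.
  by rewrite cards0 expn0 mul1n max_card.
have {IH} IH := IH (par F v) (leq_trans (depth_par nvr) dv).
apply: leq_trans IH.
have sv : subtree F v \subset subtree F (par F v).
  apply/fintype.subsetP => x; rewrite !inE => /below_trans; apply; exact: below_par.
have la : light_ancestors F v \subset v |: light_ancestors F (par F v).
  apply/fintype.subsetP => c; rewrite !inE belowE eq_sym.
  by case: eqP => //= _ /andP[-> ->].
have [/existsP[c' /andP[s w]]|nl] := boolP [exists c', light_sib F v c'].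
  apply: (@leq_trans (2 ^ #|light_ancestors F (par F v)|.+1 * #|subtree F v|)).
    rewrite leq_mul2r leq_exp2l //; apply/orP; right.
    apply: leq_trans (subset_leq_card la) _.
    by rewrite cardsU1 -add1n leq_add2r leq_b1.
  rewrite expnS mulnAC mulnC leq_mul2l mul2n -addnn; apply/orP; right.
  have /and4P[_ c'r _ /eqP pE] := s.
  have dis : [disjoint subtree F v & subtree F c'].
    rewrite -setI_eq0; apply/eqP/setP => x; rewrite !inE.
    by apply/negP => /andP[/(sib_disjoint s)/negP].
  apply: (@leq_trans #|subtree F v :|: subtree F c'|%SET).
    by rewrite cardsU (disjoint_setI0 dis) cards0 subn0 leq_add2l weight_subtree.
  apply: subset_leq_card; rewrite finset.subUset sv /= pE.
  apply/fintype.subsetP => x; rewrite !inE => /below_trans; apply; exact: below_par.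
apply: leq_mul (subset_leq_card sv); rewrite leq_exp2l //; apply: subset_leq_card.
apply/fintype.subsetP => c; rewrite !inE belowE => /andP[].
by case: eqP => [<-|_ /= -> ->//]; rewrite (negbTE nl).
Qed.

(** The vertex [c] is itself a neighbour of its parent, which saves one. *)
Lemma card_siblings (T : finType) (e : rel T) (F : rooting e) (c : T) :
  symmetric e -> (#|[set u | sib F c u]%SET| <= (max_degree e).-1)%N.
Proof.
move=> esym; have [cr|cr] := eqVneq c (root F).
  rewrite (_ : [set u | sib F c u]%SET = finset.set0) ?cards0 //.
  by apply/setP => u; rewrite !inE /sib cr eqxx.
have cN : c \in [set y | e (par F c) y]%SET by rewrite inE esym adj_par.
have : (#|[set y | e (par F c) y]%SET| <= max_degree e)%N by exact: leq_bigmax.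
rewrite (cardsD1 c) cN add1n => h; rewrite -ltnS.
apply: (@leq_trans (max_degree e)); last by case: (max_degree e).
apply: leq_ltn_trans h; apply: subset_leq_card; apply/fintype.subsetP => u.
rewrite !inE => /and4P[_ ur ncu /eqP pE]; rewrite eq_sym ncu /= pE esym; exact: adj_par.
Qed.

Lemma card_bigcup_le (T I : finType) (A : {set I}) (S : I -> {set T}) (m : nat) :
  (forall i, #|S i| <= m)%N -> (#|\bigcup_(i in A) S i| <= #|A| * m)%N.
Proof.
move=> Sm; rewrite -sum_nat_const.
elim/big_rec2: _ => [|i n B _ IH]; first by rewrite cards0.
by apply: leq_trans (leq_card_setU _ _) _; apply: leq_add.
Qed.

Lemma card_heavier (T : finType) (e : rel T) (F : rooting e) (v : T) :
  symmetric e ->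
  (#|heavier F v| <= #|light_ancestors F v| * (max_degree e).-1)%N.
Proof.
move=> esym; apply: leq_trans (card_bigcup_le _ (fun c => card_siblings F c esym)).
apply: subset_leq_card; apply/fintype.subsetP => u; rewrite inE => /existsP[c /andP[vc l]].
apply/finset.bigcupP; exists c; last by rewrite inE; case/andP: l.
by rewrite inE vc; apply/existsP; exists u.
Qed.

Lemma exp2_le_log2 (R : realType) (k n : nat) :
  (2 ^ k <= n)%N -> k%:R <= log2 n%:R :> R.
Proof.
move=> kn; have ln2 : 0 < ln 2 :> R by rewrite ln_gt0 // ltr1n.
rewrite /log2 ler_pdivlMr // mulr_natl -lnXn //.
rewrite ler_ln ?posrE ?exprn_gt0 ?ltr0n //; last by apply: leq_trans kn; rewrite expn_gt0.
by rewrite -natrX ler_nat.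
Qed.

(** * Edge vectors and distances in the drawing *)

Definition len (R : realType) (T : finType) (e : rel T) (F : rooting e) (c : T) : R :=
  (3 * #|T|)%:R ^+ index F c.

Definition slope (R : realType) (T : finType) (e : rel T) (F : rooting e) (c : T) : R :=
  (index F c)%:R / #|T|%:R.

(* The edge from [par F c] to [c] is the vector [(len c, len c * slope c)]; the
   vector attached to the root is a harmless translation. *)
Definition layout (R : realType) (T : finType) (e : rel T) (F : rooting e) (v : T) : R * R :=
  (\sum_(c | below F v c) len R F c, \sum_(c | below F v c) len R F c * slope R F c).

Lemma rooting_card (T : finType) (e : rel T) (F : rooting e) : (0 < #|T|)%N.
Proof. by apply/card_gt0P; exists (root F). Qed.

Lemma len_gt0 (R : realType) (T : finType) (e : rel T) (F : rooting e) c : 0 < len R F c.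
Proof. by rewrite exprn_gt0 // ltr0n muln_gt0 (rooting_card F). Qed.

Lemma slope_itv (R : realType) (T : finType) (e : rel T) (F : rooting e) c :
  0 <= slope R F c <= 1.
Proof.
rewrite divr_ge0 //= ler_pdivrMr ?ltr0n ?(rooting_card F) // mul1r ler_nat.
exact: index_le.
Qed.

Lemma slope_lt (R : realType) (T : finType) (e : rel T) (F : rooting e) a b :
  (index F a < index F b)%N -> slope R F a < slope R F b.
Proof. by move=> ab; rewrite ltr_pM2r ?ltr_nat // invr_gt0 ltr0n (rooting_card F). Qed.

(** Each term is a smaller power of [3 * #|T|]: the factor [#|T|] pays for the number of terms, and
    the factor 3 is left as a margin. *)
Lemma len_sum_le (R : realType) (T : finType) (e : rel T) (F : rooting e) (V : {set T}) m :
  {in V, forall b, index F b < index F m}%N ->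
  3 * \sum_(b in V) len R F b <= len R F m.
Proof.
move=> Vm; have n0 : 0 < #|T|%:R :> R by rewrite ltr0n (rooting_card F).
rewrite -(ler_pM2r n0) mulrAC -natrM mulr_sumr.
apply: (@le_trans _ _ (\sum_(b in V) len R F m)); last first.
  by rewrite sumr_const -[X in X <= _]mulr_natr ler_pM2l ?len_gt0 // ler_nat max_card.
apply: ler_sum => b /Vm bm; rewrite /len -exprS ler_weXn2l //.
by rewrite ler1n muln_gt0 (rooting_card F).
Qed.

Lemma edistC (R : realType) (a b : R * R) : edist a b = edist b a.
Proof. by rewrite /edist -sqrrN opprB -[X in _ + X]sqrrN opprB. Qed.

(** Common ancestors cancel. Two functions are allowed so that the result also applies to points
    inside edges. *)
Lemma sum_below_diff (R : realType) (T : finType) (e : rel T) (F : rooting e) u v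
    (f g : T -> R) :
  (forall c, below F u c -> below F v c -> f c = g c) ->
  \sum_(c | below F u c) f c - \sum_(c | below F v c) g c =
  \sum_(c in branch F u v) f c - \sum_(c in branch F v u) g c.
Proof.
move=> fg; rewrite (bigID (below F v)) [X in _ - X](bigID (below F u)) /=.
have -> : \sum_(c | below F u c && below F v c) f c =
          \sum_(c | below F v c && below F u c) g c.
  by under eq_bigl do rewrite andbC; apply: eq_bigr => c /andP[vc uc]; apply: fg.
rewrite opprD addrACA subrr add0r; congr (_ - _); apply: eq_bigl => c; by rewrite inE.
Qed.

Lemma sum_below_par (R : realType) (T : finType) (e : rel T) (F : rooting e) v (f : T -> R) :
  v != root F -> \sum_(c | below F v c) f c = f v + \sum_(c | below F (par F v) c) f c.
Proof.
move=> vr; rewrite (bigD1 v) ?below_refl //=; congr (_ + _); apply: eq_bigl => c.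
rewrite [below F v c]belowE eq_sym; case: eqP => [->|_]; last by rewrite andbT.
by rewrite andbF; apply/esym/negP => /below_depth; rewrite leqNgt depth_par.
Qed.

Lemma branch_root (T : finType) (e : rel T) (F : rooting e) u v c :
  c \in branch F u v -> c != root F.
Proof. by rewrite inE => /andP[_]; apply: contraNneq => ->; exact: below_root. Qed.

Lemma edist_par (R : realType) (T : finType) (e : rel T) (F : rooting e) c :
  c != root F -> edist (layout R F c) (layout R F (par F c)) =
    Num.sqrt (len R F c ^+ 2 + (len R F c * slope R F c) ^+ 2).
Proof.
by move=> cr; rewrite /edist /layout /= !(sum_below_par _ cr) !addrK.
Qed.

(** If [c] is on the heavier branch, a second edge there outweighs the whole lighter branch, so what
    is added to the edge vector of [c] has a nonnegative inner product with it. If [c] is on the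
    lighter branch, a single heavier edge already suffices. *)
Lemma branch_edge_le (R : realType) (T : finType) (e : rel T) (F : rooting e) u v c :
  {in branch F u v & branch F v u, forall a b, index F b < index F a}%N ->
  (exists a b, [/\ a \in branch F u v, b \in branch F u v & a != b]) ->
  below F u c != below F v c ->
  edist (layout R F c) (layout R F (par F c)) <= edist (layout R F u) (layout R F v).
Proof.
move=> UV [a [b [aU bU nab]]] ncuv.
have cUV : (c \in branch F u v) || (c \in branch F v u).
  by rewrite !inE; case: below ncuv; case: below.
have cr : c != root F by case/orP: cUV => /branch_root.
rewrite edist_par // ler_wsqrtr //= !sum_below_diff //.
set VX := \sum_(i in branch F v u) len R F i.
set VY := \sum_(i in branch F v u) len R F i * slope R F i.
have VX0 : 0 <= VX by apply: sumr_ge0 => w _; exact/ltW/len_gt0.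
have VY0 : 0 <= VY.
  apply: sumr_ge0 => w _; apply: mulr_ge0; first exact/ltW/len_gt0.
  by have /andP[] := slope_itv R F w.
have VYX : VY <= VX.
  apply: ler_sum => w _; rewrite ler_piMr ?(ltW (len_gt0 _ _ _)) //.
  by have /andP[] := slope_itv R F w.
have small m : m \in branch F u v -> 3 * VX <= len R F m.
  by move=> mU; apply: len_sum_le => w; apply: UV.
have /andP[s0 s1] := slope_itv R F c; have l0 := len_gt0 R F c.
have [cU|] := boolP (c \in branch F u v).
  rewrite !(bigD1 c cU) /=.
  set RX := \sum_(i in branch F u v | i != c) len R F i.
  set RY := \sum_(i in branch F u v | i != c) len R F i * slope R F i.
  have RY0 : 0 <= RY.
    apply: sumr_ge0 => w _; apply: mulr_ge0; first exact/ltW/len_gt0.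
    by have /andP[] := slope_itv R F w.
  have [m mU mc] : exists2 m, m \in branch F u v & m != c.
    by have [<-|ac] := eqVneq a c; [exists b; rewrite // eq_sym|exists a].
  have RXm : 3 * VX <= RX.
    apply: le_trans (small m mU) _; rewrite /RX (bigD1 m) ?mU //= lerDl.
    by apply: sumr_ge0 => w _; exact/ltW/len_gt0.
  move: (len R F c) (slope R F c) s0 s1 l0 => l s s0 s1 l0.
  clearbody VX VY RX RY.
  have sVX : s * VX <= VX by rewrite ler_piMl.
  (* Here [s * (RY - VY)] is at least [- VX], because [0 <= s <= 1] and [VY <= VX], while [RX - VX]
     is at least [2 * VX]. *)
  have cross : 0 <= l * (RX - VX + s * (RY - VY)).
    apply: mulr_ge0; first exact: ltW.
    have : s * (RY - VY) >= - VX.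
      apply: (@le_trans _ _ (s * - VX)); first by rewrite mulrN lerN2.
      by apply: ler_wpM2l => //; lra.
    by lra.
  rewrite -subr_ge0.
  have -> : (l + RX - VX) ^+ 2 + (l * s + RY - VY) ^+ 2 - (l ^+ 2 + (l * s) ^+ 2)
    = 2 * (l * (RX - VX + s * (RY - VY))) + ((RX - VX) ^+ 2 + (RY - VY) ^+ 2) by ring.
  by rewrite !addr_ge0 ?sqr_ge0 // mulr_ge0.
move=> cU; rewrite (negbTE cU) /= in cUV.
have lVX : len R F c <= VX.
  rewrite /VX (bigD1 c cUV) /= lerDl.
  by apply: sumr_ge0 => w _; exact/ltW/len_gt0.
set UX := \sum_(i in branch F u v) len R F i.
have UXa : 3 * VX <= UX.
  apply: le_trans (small a aU) _; rewrite /UX (bigD1 a aU) /= lerDl.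
  by apply: sumr_ge0 => w _; exact/ltW/len_gt0.
(* The margin 3 gives [UX - VX >= 2 * VX], whose square exceeds the bound [2 * VX ^+ 2] on the
   squared length of the edge. *)
apply: (@le_trans _ _ ((UX - VX) ^+ 2)); last by rewrite lerDl sqr_ge0.
apply: (@le_trans _ _ ((2 * VX) ^+ 2)); last by apply: lerXn2r; rewrite ?nnegrE; lra.
have : (len R F c * slope R F c) ^+ 2 <= VX ^+ 2.
  rewrite lerXn2r ?nnegrE ?mulr_ge0 ?(ltW l0) //.
  by apply: le_trans lVX; rewrite ler_piMr // ltW.
have : len R F c ^+ 2 <= VX ^+ 2 by rewrite lerXn2r ?nnegrE ?(ltW l0).
have : 0 <= VX ^+ 2 by exact: sqr_ge0.
have -> : (2 * VX) ^+ 2 = 4 * VX ^+ 2 by ring.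
by lra.
Qed.

(** * Bad pairs of the drawing *)

(** By [branch_edge_le] the heavier branch consists of [u] alone, so [u] is a child of the lowest
    common ancestor and a sibling of the top of the other branch. *)
Lemma short_heavier (R : realType) (T : finType) (e : rel T) (F : rooting e) u v c :
  ~~ e u v -> {in branch F u v & branch F v u, forall a b, index F b < index F a}%N ->
  branch F u v != finset.set0 -> below F u c != below F v c ->
  edist (layout R F u) (layout R F v) < edist (layout R F c) (layout R F (par F c)) ->
  u \in heavier F v.
Proof.
move=> neuv UV U0 cuv short.
have [d dU] := set0Pn _ U0.
have nvu : ~~ below F v u.
  apply/negP => vu; move: dU; rewrite inE => /andP[ud].
  by rewrite (below_trans vu ud).
have uU : u \in branch F u v by rewrite inE below_refl.
have ur := branch_root uU.
have only a : a \in branch F u v -> a = u.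
  move=> aU; apply/eqP; apply: contraTT short => nau; rewrite -leNgt.
  by apply: branch_edge_le cuv => //; exists a, u.
have vpu : below F v (par F u).
  apply: contraT => nvpu; have /only pu : par F u \in branch F u v.
    by rewrite inE below_par nvpu.
  by have := depth_par ur; rewrite pu ltnn.
(* If [v] were an ancestor of [u], it would be the parent of [u], and the pair would be adjacent. *)
have V0 : branch F v u != finset.set0.
  apply/set0Pn; exists v; rewrite inE below_refl belowE negb_or.
  rewrite (contraNneq _ nvu) => [|->]; last exact: below_refl.
  apply/negP => puv; have vE := below_anti vpu puv.
  by move: neuv; rewrite vE adj_par.
have [c1 [c2 [s /only cu c2V _ _]]] := branch_sib U0 V0.
rewrite {}cu in s; rewrite inE; apply/existsP; exists c2.
have := c2V; rewrite inE => /andP[-> _]; rewrite /light_sib sib_sym s /= ltnNge.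
(* Were [u] the lighter sibling, the numbers would be ordered the other way. *)
have /and4P[_ _ nuc2 _] := s; apply/negP; rewrite leq_eqVlt => /orP[/eqP/weight_inj E|w].
  by rewrite E eqxx in nuc2.
have := UV u c2 uU c2V; rewrite ltnNge ltnW //.
by apply: (@index_light_sib _ _ F u c2); rewrite ?below_refl // /light_sib s.
Qed.

Lemma bad_heavier (R : realType) (T : finType) (e : rel T) (F : rooting e) u v :
  symmetric e -> bad e (layout R F) u v -> (u \in heavier F v) || (v \in heavier F u).
Proof.
move=> esym [nuv neuv [p [w [z [sp wz short]]]]].
have [c [cr cuv cwz]] := simple_path_edge F sp wz.
have {}short : edist (layout R F u) (layout R F v) <
    edist (layout R F c) (layout R F (par F c)).
  by case: cwz short => -[-> ->] //; rewrite [edist (layout R F (par F c)) _]edistC.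
have short' := short; rewrite edistC in short'.
have neither x y : below F x c != below F y c -> branch F x y = finset.set0 ->
    branch F y x != finset.set0.
  move=> cxy xy; apply/set0Pn; exists c; rewrite inE.
  have : c \notin branch F x y by rewrite xy inE.
  by rewrite inE; case: below cxy; case: below.
have cvu : below F v c != below F u c by rewrite eq_sym.
have nevu : ~~ e v u by rewrite esym.
(* If one end is an ancestor of the other, a branch is empty and the comparison of numbers holds
   vacuously. *)
have [V0|V0] := eqVneq (branch F v u) finset.set0.
  apply/orP; left; apply: short_heavier short => //; last exact: neither V0.
  by move=> a b _; rewrite V0 inE.
have [U0|U0] := eqVneq (branch F u v) finset.set0.
  apply/orP; right; apply: short_heavier short' => //.
  by move=> a b _; rewrite U0 inE.
case: (branch_index F u v) => h; apply/orP; [right|left].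
  by apply: short_heavier short' => // a b aV bU; apply: h.
exact: short_heavier short.
Qed.

Lemma card_bad_pairs (R : realType) (T : finType) (e : rel T) (F : rooting e) :
  symmetric e -> (#|bad_pairs e (layout R F)| <= \sum_v #|heavier F v|)%N.
Proof.
move=> esym; pose S := [set x : T * T | x.1 \in heavier F x.2]%SET.
have sub : bad_pairs e (layout R F) \subset [set [set x.1; x.2]%SET | x in S]%SET.
  apply/fintype.subsetP => _ /imsetP[[u v] + ->]; rewrite inE => /asboolP /= b.
  have /orP[h|h] := bad_heavier esym b; apply/imsetP.
    by exists (u, v) => //; rewrite finset.in_set.
  by exists (v, u); [rewrite finset.in_set|rewrite finset.setUC].
apply: leq_trans (subset_leq_card sub) _; apply: leq_trans (leq_imset_card _ _) _.
rewrite -sum1_card (eq_bigl (fun x : T * T => x.1 \in heavier F x.2)); last first.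
  by move=> x; rewrite inE.
under [leqRHS]eq_bigr do rewrite -sum1_card.
by rewrite (exchange_big_dep xpredT) //= pair_big_dep.
Qed.

(** * Planarity of the drawing *)

(** The cross product of the two vector sums expands into the terms [f a * g b * (s b - s a)], all
    nonnegative. It vanishes when the sums agree, while a positive [f a] and a positive [g b] would
    make one term positive. *)
Lemma separated_slopes (R : realType) (I : finType) (A B : {set I}) (f g s : I -> R) :
  (forall i, 0 <= f i) -> (forall i, 0 <= g i) ->
  {in A & B, forall a b, s a < s b} ->
  \sum_(a in A) f a = \sum_(b in B) g b ->
  \sum_(a in A) f a * s a = \sum_(b in B) g b * s b ->
  \sum_(a in A) f a = 0.
Proof.
move=> f0 g0 sAB fg fgs; apply/eqP/negPn/negP => /eqP fn0.
have gn0 : \sum_(b in B) g b <> 0 by rewrite -fg.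
have [a /andP[aA fa]] := psumr_neq0P (fun i _ => f0 i) fn0.
have [b /andP[bB gb]] := psumr_neq0P (fun i _ => g0 i) gn0.
pose h a b := f a * g b * (s b - s a).
have h0 x y : x \in A -> y \in B -> 0 <= h x y.
  by move=> xA yB; rewrite !mulr_ge0 // subr_ge0 ltW // sAB.
have h_sum : \sum_(x in A) \sum_(y in B) h x y = 0.
  transitivity ((\sum_(a in A) f a) * (\sum_(b in B) g b * s b)
      - (\sum_(a in A) f a * s a) * (\sum_(b in B) g b)).
    rewrite !big_distrlr -sumrB; apply: eq_bigr => x _.
    by rewrite -sumrB; apply: eq_bigr => y _; rewrite /h /=; ring.
  by rewrite -fg -fgs mulrC subrr.
have h_row x : x \in A -> 0 <= \sum_(y in B) h x y.
  by move=> xA; apply: sumr_ge0 => y; apply: h0.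
have hab : h a b = 0 := psumr_eq0P (fun y => h0 a y aA) (psumr_eq0P h_row h_sum aA) bB.
have : 0 < h a b by rewrite !mulr_gt0 // subr_gt0 sAB.
by rewrite hab ltxx.
Qed.

(** A point on the edge above [w] is the sum of the edge vectors on the way from the root, with the
    last one scaled by [t]. *)
Definition edge_weight (R : realType) (T : finType) (w : T) (t : R) (c : T) : R :=
  if c == w then t else 1.

Lemma segpoint_layout (R : realType) (T : finType) (e : rel T) (F : rooting e) w t :
  w != root F -> segpoint (layout R F (par F w)) (layout R F w) t =
  (\sum_(c | below F w c) edge_weight w t c * len R F c,
   \sum_(c | below F w c) edge_weight w t c * len R F c * slope R F c).
Proof.
move=> wr; rewrite /segpoint /layout /= !(sum_below_par _ wr).
have one c : below F (par F w) c -> edge_weight w t c = 1.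
  rewrite /edge_weight; case: eqP => // -> /below_depth.
  by rewrite leqNgt depth_par.
rewrite {1 3}/edge_weight eqxx; congr (_, _).
  rewrite [in RHS](eq_bigr (fun c => len R F c)) => [|c /one ->]; first by ring.
  by rewrite mul1r.
rewrite [in RHS](eq_bigr (fun c => len R F c * slope R F c)) => [|c /one ->]; first by ring.
by rewrite mul1r.
Qed.

(** After cancelling common ancestors, both points are sums over branches with separated slopes. If
    they agreed, both sums would vanish, but [t > 0] makes the term of [w] positive. *)
Lemma segpoint_incomparable (R : realType) (T : finType) (e : rel T) (F : rooting e)
    w w' (t t' : R) :
  w != root F -> w' != root F -> ~~ below F w w' -> ~~ below F w' w ->
  0 < t -> 0 <= t' ->
  segpoint (layout R F (par F w)) (layout R F w) t <>
  segpoint (layout R F (par F w')) (layout R F w') t'.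
Proof.
move=> wr w'r nww' nw'w t0 t0'; rewrite !segpoint_layout // => -[/eqP EX /eqP EY].
(* A common ancestor is neither [w] nor [w'], so its weight is 1 on both sides. *)
have common c : below F w c -> below F w' c -> edge_weight w t c = edge_weight w' t' c.
  move=> wc w'c; rewrite /edge_weight; case: eqP => [cw|_].
    by rewrite -cw w'c in nw'w.
  by case: eqP => // cw'; rewrite -cw' wc in nww'.
move: EX EY; rewrite -subr_eq0 (@sum_below_diff R T e F); last first.
  by move=> c wc w'c; rewrite common.
move=> EX; rewrite -subr_eq0 (@sum_below_diff R T e F); last first.
  by move=> c wc w'c; rewrite common.
move: EX; rewrite !subr_eq0 => /eqP EX /eqP EY.
have f0 x (r : R) c : 0 <= r -> 0 <= edge_weight x r c * len R F c.
  move=> r0; rewrite mulr_ge0 ?(ltW (len_gt0 _ _ _)) // /edge_weight.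
  by case: ifP => _ //; exact: ler01.
have pos : 0 < \sum_(c in branch F w w') edge_weight w t c * len R F c.
  rewrite (bigD1 w) ?inE ?below_refl //= ltr_wpDr //.
    by apply: sumr_ge0 => c _; apply/f0/ltW.
  by rewrite /edge_weight eqxx mulr_gt0 ?len_gt0.
have fw c := f0 w t c (ltW t0); have fw' c := f0 w' t' c t0'.
case: (branch_index F w w') => h.
  move: pos; rewrite (separated_slopes fw fw' _ EX EY) ?ltxx // => a b aA bB.
  by apply: slope_lt; apply: h.
move: pos; rewrite EX (separated_slopes fw' fw _ (esym EX) (esym EY)) ?ltxx // => b a bB aA.
by apply: slope_lt; apply: h.
Qed.

Lemma layout_below (R : realType) (T : finType) (e : rel T) (F : rooting e) u v :
  below F v u -> (layout R F u).1 <= (layout R F v).1.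
Proof.
move=> vu; rewrite /= [leRHS](bigID (below F u)) /=.
rewrite (eq_bigl (fun c => below F v c && below F u c)); last first.
  by move=> c; case uc: (below F u c); rewrite ?andbF ?(below_trans vu uc).
by rewrite lerDl; apply: sumr_ge0 => c _; exact/ltW/len_gt0.
Qed.

Lemma segpoint_fst (R : realType) (T : finType) (e : rel T) (F : rooting e) w (t : R) :
  w != root F -> (segpoint (layout R F (par F w)) (layout R F w) t).1 =
  (layout R F (par F w)).1 + t * len R F w.
Proof. by move=> wr; rewrite /= !(sum_below_par _ wr); ring. Qed.

Lemma layout_par_lt (R : realType) (T : finType) (e : rel T) (F : rooting e) w :
  w != root F -> (layout R F (par F w)).1 < (layout R F w).1.
Proof. by move=> wr; rewrite /= (sum_below_par _ wr) ltrDr len_gt0. Qed.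

Lemma layout_inj (R : realType) (T : finType) (e : rel T) (F : rooting e) :
  injective (layout R F).
Proof.
have lt x y : x != y -> below F y x -> (layout R F x).1 < (layout R F y).1.
  move=> nxy; have [yE|yr] := eqVneq y (root F).
    by rewrite yE => /below_rootl xr; rewrite xr yE eqxx in nxy.
  rewrite belowE eq_sym (negbTE nxy) => /(layout_below R) h.
  exact: le_lt_trans h (layout_par_lt R yr).
move=> u v E; apply/eqP/negPn/negP => nuv.
have [vu|nvu] := boolP (below F v u); first by have := lt u v nuv vu; rewrite E ltxx.
have [uv|nuv'] := boolP (below F u v).
  by have := lt v u; rewrite eq_sym nuv uv E ltxx => /(_ isT isT).
have ur : u != root F by apply: contraNneq nvu => ->; exact: below_root.
have vr : v != root F by apply: contraNneq nuv' => ->; exact: below_root.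
apply: (@segpoint_incomparable R T e F u v 1 1) => //.
have seg1 (a b : R * R) : segpoint a b 1 = b.
  by rewrite /segpoint subrr !mul0r !add0r !mul1r; case: b.
by rewrite !seg1.
Qed.

Lemma segpoint_sym (R : realType) (a b : R * R) t : segpoint a b t = segpoint b a (1 - t).
Proof. by rewrite /segpoint; congr (_, _); ring. Qed.

Lemma edge_orient (R : realType) (T : finType) (e : rel T) (F : rooting e) u v :
  e u v -> exists2 c, c != root F /\ [set u; v]%SET = [set c; par F c]%SET &
    forall t : R, segpoint (layout R F u) (layout R F v) t =
        segpoint (layout R F (par F c)) (layout R F c) t \/
      segpoint (layout R F u) (layout R F v) t =
        segpoint (layout R F (par F c)) (layout R F c) (1 - t).
Proof.
move=> euv; case: (adj_rooting F euv) => -[-> r].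
  by exists u => // t; right; exact: segpoint_sym.
by exists v; [rewrite finset.setUC|left].
Qed.

(** First coordinates grow away from the root, so two edges on one chain lie in vertical strips that
    share at most a boundary line, which misses the interior of the first edge. Other edges are
    handled by [segpoint_incomparable]. *)
Lemma layout_planar (R : realType) (T : finType) (e : rel T) (F : rooting e) :
  planar_drawing e (layout R F).
Proof.
split; first exact: layout_inj.
move=> u v w z euv ewz nE; apply/seteqP; split=> // x [[t t01 xE] [t' t01' xE']].
have [c [cr cE] cP] := edge_orient R F euv; have [d [dr dE] dP] := edge_orient R F ewz.
have ncd : c != d by apply: contraNneq nE => cd; rewrite cE dE cd.
(* Orienting an edge from parent to child may replace [t] by [1 - t], which preserves the open and
   the closed unit interval. *)
have [{xE t01}t t01 xE] : exists2 t0, 0 < t0 < 1 &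
    x = segpoint (layout R F (par F c)) (layout R F c) t0.
  by case: (cP t) => E; [exists t|exists (1 - t)]; rewrite -?E //; lra.
have [{xE' t01'}t' t01' xE'] : exists2 t0, 0 <= t0 <= 1 &
    x = segpoint (layout R F (par F d)) (layout R F d) t0.
  by case: (dP t') => E; [exists t'|exists (1 - t')]; rewrite -?E //; lra.
have /andP[t0 t1] := t01; have /andP[t0' t1'] := t01'.
have lc := len_gt0 R F c; have ld := len_gt0 R F d.
have xc : x.1 = (layout R F (par F c)).1 + t * len R F c by rewrite xE segpoint_fst.
have xd : x.1 = (layout R F (par F d)).1 + t' * len R F d by rewrite xE' segpoint_fst.
have Xc : (layout R F c).1 = (layout R F (par F c)).1 + len R F c.
  by rewrite /= (sum_below_par _ cr) addrC.
have Xd : (layout R F d).1 = (layout R F (par F d)).1 + len R F d.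
  by rewrite /= (sum_below_par _ dr) addrC.
have tc0 : 0 < t * len R F c by rewrite mulr_gt0.
have tc1 : t * len R F c < len R F c by rewrite gtr_pMl.
have td0 : 0 <= t' * len R F d by rewrite mulr_ge0 // ltW.
have td1 : t' * len R F d <= len R F d by rewrite ler_piMl // ltW.
have [cd|ncd'] := boolP (below F c d).
  have := cd; rewrite belowE (negbTE ncd) => /(layout_below R) h.
  by move: xc xd Xc Xd h; lra.
have [dc|ndc] := boolP (below F d c).
  have := dc; rewrite belowE eq_sym (negbTE ncd) => /(layout_below R) h.
  by move: xc xd Xc Xd h; lra.
by apply: (@segpoint_incomparable R T e F c d t t') => //; rewrite -xE -xE'.
Qed.

(** * Assembling the bound *)

Theorem theorem29 (R : realType) (T : finType) (e : rel T)
    (He : is_tree e) (Hn : (2 <= #|T|)%N) :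
  (bp R e < ((max_degree e)%:R ^+ 2 * #|T|%:R * log2 #|T|%:R)%R%:E)%E.
Proof.
have [[esym _] _ _ _] := He; have [F] := tree_rooting He.
set L : R := log2 #|T|%:R; set D := max_degree e.
have L0 : 0 < L.
  by apply: lt_le_trans ltr01 _; apply: (@exp2_le_log2 R 1).
have D0 : (0 < D)%N.
  have [v vr] : exists v, v != root F.
    have : (0 < #|[set~ root F]%SET|)%N by rewrite cardsC1; case: #|T| Hn => [|[]].
    by move=> /card_gt0P[v]; rewrite !inE => ?; exists v.
  apply: (@leq_trans #|[set y | e v y]%SET|); last exact: leq_bigmax.
  by apply/card_gt0P; exists (par F v); rewrite inE adj_par.
apply: (@le_lt_trans _ _ (#|bad_pairs e (layout R F)|%:R)%:E).
  by apply: ereal_inf_lbound; exists (layout R F) => //; exact: layout_planar.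
(* Each vertex contributes at most [L * D.-1]. The strict inequality comes from [D.-1 < D ^ 2], as
   [D] is positive. *)
rewrite lte_fin; apply: (@le_lt_trans _ _ (#|T|%:R * (L * D.-1%:R))).
  apply: (@le_trans _ _ (\sum_v #|heavier F v|)%N%:R).
    by rewrite ler_nat card_bad_pairs.
  rewrite natr_sum mulr_natl -sumr_const; apply: ler_sum => v _.
  apply: (@le_trans _ _ (#|light_ancestors F v| * D.-1)%N%:R).
    by rewrite ler_nat card_heavier.
  rewrite natrM ler_wpM2r //; apply: exp2_le_log2.
  (* The subtree of [v] contains [v], so the factor for its size is at least 1. *)
  apply: leq_trans (card_light_ancestors F v); apply: leq_pmulr.
  by apply/card_gt0P; exists v; rewrite inE below_refl.
have -> : D%:R ^+ 2 * #|T|%:R * L = #|T|%:R * (L * D%:R ^+ 2) by ring.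
rewrite ltr_pM2l ?ltr0n ?(rooting_card F) // ltr_pM2l //.
rewrite -natrX ltr_nat; apply: (@leq_trans D); first by rewrite prednK.
by rewrite -mulnn leq_pmulr.
Qed.
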